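(* Let $G$ be a finite simple graph with $n$ vertices and $m$ edges, without isolated vertices, and with independence number $\alpha=\alpha(G)$. If $$n(n-\alpha)(n-\alpha-1)\le 8m,$$ then $$s_Q(G)\ \ge\ 2\lambda_1-\upsilon_b(G)\ \ge\ \frac{4m}{n}-\upsilon_b(G)\ \ge\ 0.$$
   Context: For a finite simple graph $G$ on $n$ vertices, let $A_G$ be its adjacency matrix, with largest eigenvalue $\lambda_1$, and $D_G$ the diagonal matrix of vertex degrees. The signless Laplacian matrix is $Q_G=D_G+A_G$ with eigenvalues $q_1\ge q_2\ge\cdots\ge q_n$, and the signless Laplacian spread is $s_Q(G)=q_1-q_n$. The vertex bipartiteness $\upsilon_b(G)$ is the minimum number of vertices of $G$ whose deletion yields a bipartite graph. The independence number $\alpha(G)$ is the maximum size of a set of pairwise non-adjacent vertices. *)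

(* Defs.v *)
From mathcomp Require Import all_boot all_order all_algebra.
From mathcomp Require Import polyrcf complex.

Set Implicit Arguments.
Unset Strict Implicit.
Unset Printing Implicit Defensive.

Import Order.TTheory GRing.Theory Num.Theory.
Local Open Scope ring_scope.

(* A finite simple graph on V is a symmetric irreflexive [e : rel V]; the      *)
(* graph parameters below are defined for any relation.                        *)
Section GraphParameters.
Variables (V : finType) (e : rel V).

Definition edges : {set {set V}} :=
  [set [set p.1; p.2] | p : V * V & e p.1 p.2].

Definition degree (u : V) : nat := #|[set v | e u v]|.

Definition no_isolated_vertex := forall u : V, (0 < degree u)%N.

Definition independent (S : {set V}) : bool :=
  [forall u in S, forall v in S, ~~ e u v].

Definition independence_number : nat :=
  (\max_(S : {set V} | independent S) #|S|)%N.

Definition bipartite : bool :=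
  [exists X : {set V}, forall u, forall v, e u v ==> ((u \in X) != (v \in X))].

Definition delete_vertices (S : {set V}) : rel {u : V | u \notin S} :=
  relpre val e.

End GraphParameters.

Arguments delete_vertices {V} e S.

(* The default [set: V] of the arg min satisfies the condition, since deleting *)
(* every vertex leaves the empty graph (see [delete_setT_bipartite]).          *)
Definition vertex_bipartiteness (V : finType) (e : rel V) : nat :=
  #|[arg min_(S < [set: V] | bipartite (delete_vertices e S)) #|S|]|.

Lemma delete_setT_bipartite (V : finType) (e : rel V) :
  bipartite (delete_vertices e [set: V]).
Proof.
by apply/existsP; exists set0; apply/forallP => u; have := valP u; rewrite inE.
Qed.

Section Spectrum.
Variables (R : rcfType) (n : nat).

(* The roots in R of the characteristic polynomial, repeated according to      *)
(* algebraic multiplicity and listed in nonincreasing order ([rootsR] lists    *)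
(* the distinct roots in increasing order).  A symmetric matrix has exactly n  *)
(* of them (see [eigenvaluesP]).                                               *)
Definition eigenvalues (A : 'M[R]_n) : seq R :=
  flatten [seq nseq (mup x (char_poly A)) x | x <- rev (rootsR (char_poly A))].

Lemma eigenvaluesP (A : 'M[R]_n) : A^T = A ->
  char_poly A = \prod_(x <- eigenvalues A) ('X - x%:P).
Proof.
move=> symA.
pose f := real_complex R.
pose B := map_mx f A.
have hB : B \is hermsymmx.
  apply/is_hermitianmxP; rewrite expr0 scale1r.
  apply/matrixP => i j; rewrite !mxE -[in LHS]symA mxE; exact/esym/conjc_real.
have eB := orthomx_spectralP (hermitian_normalmx hB).
have rB := hermitian_spectral_diag_real hB.
set P := spectralmx B in eB; set d := spectral_diag B in eB rB.
have Pu : P \in unitmx by apply: spectral_unit.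
have cB : char_poly B = \prod_i ('X - (f (complex.Re (d 0 i)))%:P).
  have -> : char_poly B = char_poly (diag_mx d).
    rewrite eB /char_poly /char_poly_mx.
    have -> : 'X%:M - map_mx polyC (invmx P *m diag_mx d *m P) =
        map_mx polyC (invmx P) *m ('X%:M - map_mx polyC (diag_mx d)) *m map_mx polyC P.
      rewrite mulmxBr mulmxBl !map_mxM /=; congr (_ - _).
      by rewrite scalar_mxC -mulmxA -map_mxM mulVmx // map_mx1 mulmx1.
    rewrite !det_mulmx mulrAC -det_mulmx -map_mxM mulVmx // map_mx1 det1 mul1r //.
  rewrite char_poly_trig; last by apply: diag_mx_is_trig.
  apply: eq_bigr => i _; rewrite mxE eqxx mulr1n; congr (_ - _%:P).
  by rewrite /f /=; apply/esym/RRe_real; move/mxOverP: rB; apply.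
pose s := [seq complex.Re (d 0 i) | i <- enum 'I_n].
have cA : char_poly A = \prod_(x <- s) ('X - x%:P).
  apply: (@map_poly_inj _ _ (real_complex R : {rmorphism R -> R[i]})).
  rewrite map_char_poly [LHS]cB rmorph_prod big_map big_enum /=.
  by apply: eq_bigr => i _; rewrite rmorphB /= map_polyX map_polyC.
rewrite [LHS]cA; apply: perm_big; apply/allP => x _ /=; apply/eqP.
have p0 : char_poly A != 0 by rewrite monic_neq0 ?char_poly_monic.
rewrite -mu_prod_XsubC -cA /eigenvalues.
rewrite count_flatten -map_comp sumnE big_map.
under eq_bigr do rewrite /= count_nseq /=.
have [rx|nrx] := boolP (root (char_poly A) x).
  rewrite (bigD1_seq x) /= ?rev_uniq ?uniq_roots //; last first.
    by rewrite mem_rev -(roots_on_rootsR p0) // inE /= in_itv.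
  by rewrite eqxx mul1n big1 ?addn0 // => y /negPf ->.
rewrite mupNroot // big_seq big1 // => y; rewrite mem_rev -(roots_on_rootsR p0).
by case: eqP => [->|//]; rewrite (negPf nrx) andbF.
Qed.

Lemma eigenvalues_sorted (A : 'M[R]_n) : sorted >=%R (eigenvalues A).
Proof.
rewrite /eigenvalues.
have : sorted >%R (rev (rootsR (char_poly A))) by rewrite rev_sorted sorted_roots.
rewrite (sorted_pairwise (rev_trans lt_trans)) (sorted_pairwise (rev_trans le_trans)).
elim: (rev _) => //= x s IH /andP[xs /IH {}IH].
rewrite pairwise_cat IH andbT; apply/andP; split.
  apply/allrelP => a b /nseqP[-> _] /flattenP[t /mapP[y ys ->] /nseqP[-> _]].
  exact/ltW/(allP xs).
by elim: (mup x _) => //= k ->; rewrite andbT; apply/allP => y /nseqP[-> _]; rewrite /= lexx.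
Qed.

Variable e : rel 'I_n.

Definition adjacency_matrix : 'M[R]_n := \matrix_(i, j) (e i j)%:R.

Definition degree_matrix : 'M[R]_n := diag_mx (\row_i (degree e i)%:R).

Definition signless_laplacian : 'M[R]_n := degree_matrix + adjacency_matrix.

(* Indexing is 0-based: the i-th largest eigenvalue is entry i.-1.             *)
Definition lambda1 : R := (eigenvalues adjacency_matrix)`_0.

Definition signless_spread : R :=
  (eigenvalues signless_laplacian)`_0 - (eigenvalues signless_laplacian)`_n.-1.

End Spectrum.

(* Main.v *)
(* Write q_1 and q_n for the extreme eigenvalues of Q = D + A and u for the     *)
(* vertex bipartiteness.  Three Rayleigh quotients give the first two           *)
(* inequalities.  An eigenvector of A for lambda_1 gives q_1 >= 2 lambda_1,     *)
(* since Q - 2 A = D - A is positive semidefinite.  If deleting S, #|S| = u,    *)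
(* leaves a bipartite graph, the vector equal to +1 and -1 on its two sides and *)
(* to 0 on S gives q_n <= u: only edges between S and its complement            *)
(* contribute to its Q-form, and there are at most u (n - u) of them.  The      *)
(* all-one vector gives lambda_1 >= 2m/n.  Finally, deleting all but one vertex *)
(* outside a maximum independent set leaves a bipartite graph, so               *)
(* u <= max (n - alpha - 1, 0), and the hypothesis then gives u <= 4m/n.        *)
Require Import Defs.
From mathcomp Require Import all_boot all_order all_algebra.
From mathcomp Require Import complex ring lra zify.
Import Order.TTheory GRing.Theory Num.Theory.
Local Open Scope ring_scope.
Local Open Scope sesquilinear_scope.

(** * Vertex bipartiteness and explicit deletions *)

Section VertexBipartiteness.
Variables (V : finType) (e : rel V).

(** One side of the bipartition is taken as a subset of all of [V], so later arguments avoid the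
    subtype of surviving vertices. *)
Lemma bipartite_deleteP (S : {set V}) :
  reflect (exists X : {set V}, forall u v, u \notin S -> v \notin S ->
             e u v -> (u \in X) != (v \in X))
          (bipartite (delete_vertices e S)).
Proof.
apply: (iffP existsP) => [[X /forallP bipX]|[X bipX]].
  exists (val @: X) => u v uS vS euv.
  have /forallP/(_ (Sub v vS))/implyP := bipX (Sub u uS).
  by rewrite -!(mem_imset X _ val_inj) !SubK; apply.
exists [set u | val u \in X]; apply/forallP => u; apply/forallP => v.
by apply/implyP => euv; rewrite !inE bipX ?(valP u) ?(valP v).
Qed.

Lemma vertex_bipartiteness_le (S : {set V}) :
  bipartite (delete_vertices e S) -> (vertex_bipartiteness e <= #|S|)%N.
Proof.
rewrite /vertex_bipartiteness; case: arg_minnP => [|T _ minT /minT //].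
exact: delete_setT_bipartite.
Qed.

Lemma vertex_bipartiteness_witness :
  exists2 S : {set V}, bipartite (delete_vertices e S)
                     & #|S| = vertex_bipartiteness e.
Proof.
rewrite /vertex_bipartiteness; case: arg_minnP => [|T bipT _].
  exact: delete_setT_bipartite.
by exists T.
Qed.

Lemma vertex_bipartiteness_independent (I : {set V}) :
  irreflexive e -> independent e I ->
  (vertex_bipartiteness e <= (#|V| - #|I|).-1)%N.
Proof.
move=> e_irr /'forall_in_forall_inP indI.
have cardC : #|~: I| = (#|V| - #|I|)%N by rewrite cardsCs setCK.
(* If [I] is everything, there are no edges and nothing is deleted. Otherwise a vertex [x] outside
   [I] is kept, with sides [[set x]] and [I]. *)
have [C0|[x xC]] := set_0Vmem (~: I).
  have inI u : u \in I by rewrite -[I]setCK C0 !inE.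
  apply: (@leq_trans #|set0 : {set V}|); last by rewrite cards0.
  apply/vertex_bipartiteness_le/bipartite_deleteP; exists set0 => u v _ _ euv.
  by have := indI u (inI u) v (inI v); rewrite euv.
apply: (@leq_trans #|~: I :\ x|); last by rewrite -cardC (cardsD1 x (~: I)) xC.
apply/vertex_bipartiteness_le/bipartite_deleteP; exists [set x] => u v.
rewrite !inE !negb_and !negbK.
have [->|_] := eqVneq u x; have [->|_] := eqVneq v x => //=.
  by rewrite e_irr.
by move=> uI vI euv; have := indI u uI v vI; rewrite euv.
Qed.

End VertexBipartiteness.

(** Ordered adjacent pairs are grouped by their unordered pair; the fibre over an edge is
    [[set (u, v); (v, u)]], of size 2 as there are no loops. *)
Lemma handshake (V : finType) (e : rel V) :
  symmetric e -> irreflexive e ->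
  (\sum_u \sum_v e u v = 2 * #|edges e|)%N.
Proof.
move=> e_sym e_irr; rewrite pair_big /=.
have -> : (\sum_(p : V * V) e p.1 p.2 = \sum_(p in [set p | e p.1 p.2]) 1)%N.
  rewrite [RHS]big_mkcond /=.
  by apply: eq_bigr => p _; rewrite inE; case: (e _ _).
rewrite (partition_big_imset (fun p : V * V => [set p.1; p.2])) /=.
rewrite -[in RHS]sum1_card big_distrr /=.
have -> : [set [set p.1; p.2] | p in [set p | e p.1 p.2]] = edges e.
  apply/setP => E; apply/imsetP/imsetP => -[p]; rewrite ?inE => ep ->;
    by exists p; rewrite ?inE.
apply: eq_bigr => _ /imsetP[[u v] /= euv ->]; rewrite muln1 inE /= in euv *.
have uv : u != v by apply: contraTneq euv => ->; rewrite e_irr.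
have <- : #|[set (u, v); (v, u)]| = 2%N.
  by rewrite cards2 xpair_eqE (negPf uv).
rewrite -sum1_card; apply: eq_bigl => -[a b]; rewrite !inE !xpair_eqE /=.
apply/andP/orP => [[eab /eqP abE]|[]/andP[/eqP-> /eqP->]]; last 2 first.
- by [].
- by rewrite e_sym setUC.
have ab : a != b by apply: contraTneq eab => ->; rewrite e_irr.
have := set21 a b; have := set22 a b; rewrite abE !inE.
by case/orP=> /eqP bE /orP[]/eqP aE; rewrite aE bE ?eqxx // in ab *;
  [right|left].
Qed.

(** * Rayleigh quotients through the spectral theorem *)

Section Rayleigh.
Variables (R : rcfType) (n : nat) (A : 'M[R]_n).
Hypothesis A_sym : A^T = A.

Lemma mem_eigenvalues x : (x \in eigenvalues A) = root (char_poly A) x.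
Proof. by rewrite eigenvaluesP // root_prod_XsubC. Qed.

Lemma size_eigenvalues : size (eigenvalues A) = n.
Proof.
by have := size_char_poly A; rewrite eigenvaluesP // size_prod_XsubC => -[].
Qed.

Lemma eigenvalues_le_head x : x \in eigenvalues A -> x <= (eigenvalues A)`_0.
Proof.
move=> xA; have := eigenvalues_sorted A.
rewrite (sorted_pairwise (rev_trans le_trans)) => /(pairwiseP 0) sA.
rewrite -(nth_index 0 xA); case: (posnP (index x (eigenvalues A))) => [->//|i0].
have := xA; rewrite -index_mem => ltis.
by apply: sA; rewrite ?inE // (leq_ltn_trans _ ltis).
Qed.

Lemma eigenvalues_ge_last x :
  x \in eigenvalues A -> (eigenvalues A)`_n.-1 <= x.
Proof.
move=> xA; have := eigenvalues_sorted A.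
rewrite (sorted_pairwise (rev_trans le_trans)) => /(pairwiseP 0) sA.
have := xA; rewrite -index_mem size_eigenvalues => ltin.
rewrite -(nth_index 0 xA).
have [->//|ne] := eqVneq (index x (eigenvalues A)) n.-1.
move: (index _ _) ltin ne => k ltkn ne.
by apply: sA; rewrite ?inE ?size_eigenvalues; lia.
Qed.

(** In an orthonormal eigenbasis, [w i] is the squared modulus of the [i]-th coordinate of [v]. The
    basis is found over [R[i]], and real parts bring the weights back to [R]. *)
Lemma rayleigh_weights (v : 'rV[R]_n) :
  exists mu w : 'I_n -> R,
  [/\ forall i, mu i \in eigenvalues A, forall i, 0 <= w i,
      (v *m A *m v^T) 0 0 = \sum_i mu i * w i
    & (v *m v^T) 0 0 = \sum_i w i].
Proof.
pose f : {rmorphism R -> R[i]} := real_complex R; pose B := map_mx f A.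
have B_herm : B \is hermsymmx.
  apply/is_hermitianmxP; rewrite expr0 scale1r; apply/matrixP => i j.
  by rewrite !mxE -[in LHS]A_sym mxE; apply/esym/conjc_real.
have := orthomx_spectralP (hermitian_normalmx B_herm).
set P := spectralmx B; set d := spectral_diag B => BE.
have PU : P \is unitarymx by apply: spectral_unitarymx.
pose u := map_mx f v; pose y := u *m P ^t*.
have ut : u ^t* = map_mx f v^T.
  by apply/matrixP => i j; rewrite !mxE; apply: conjc_real.
have yt : y ^t* = P *m u ^t* by rewrite trmx_mul map_mxM /= trmxCK.
(* Row [i] of the invertible matrix [P] is an eigenvector of [B] for [d 0 i], and the roots of
   [char_poly B] are the images of those of [char_poly A]. *)
have d_eig i : d 0 i \in map f (eigenvalues A).
  rewrite -root_prod_XsubC.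
  have <- : char_poly B = \prod_(x <- map f (eigenvalues A)) ('X - x%:P).
    rewrite -map_char_poly eigenvaluesP // rmorph_prod big_map.
    by apply: eq_bigr => x _; rewrite rmorphB /= map_polyX map_polyC.
  rewrite -eigenvalue_root_char; apply/eigenvalueP; exists (row i P).
    rewrite {1}BE -!row_mul 2!mulmxA mulmxV ?spectral_unit // mul1mx.
    by rewrite row_mul row_diag_mx -scalemxAl -rowE.
  apply: contraTneq (spectral_unit B) => rP0.
  rewrite -row_free_unit; apply/row_freeP => -[P' /(congr1 (row i))].
  rewrite row_mul rP0 mul0mx => /rowP/(_ i)/eqP.
  by rewrite !mxE eqxx eq_sym oner_eq0.
have dE i : d 0 i = f (complex.Re (d 0 i)) by have /mapP[x _ ->] := d_eig i.
have yE i : y 0 i * (y 0 i)^* = f (complex.Re (y 0 i * (y 0 i)^*)).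
  by rewrite /f /= RRe_real // -normCK realX ?normr_real.
exists (fun i => complex.Re (d 0 i)), (fun i => complex.Re (y 0 i * (y 0 i)^*)).
have f_inj : injective f by apply: fmorph_inj.
split=> [i|i||].
- by have /mapP[x xA ->] := d_eig i.
- by have := exprn_ge0 2 (normr_ge0 (y 0 i)); rewrite normCK yE ler0c.
- apply: f_inj; rewrite rmorph_sum /=.
  transitivity ((u *m B *m u ^t*) 0 0); first by rewrite ut -!map_mxM [RHS]mxE.
  rewrite BE (invmx_unitary PU) 2!mulmxA -/y -[_ *m P *m _]mulmxA -yt.
  rewrite mul_mx_diag mxE; apply: eq_bigr => i _.
  by rewrite rmorphM /= -dE -yE !mxE; ring.
- apply: f_inj; rewrite rmorph_sum /=.
  transitivity ((u *m u ^t*) 0 0); first by rewrite ut -!map_mxM [RHS]mxE.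
  have -> : u *m u ^t* = y *m y ^t*.
    rewrite yt mulmxA -[y *m P]mulmxA -(invmx_unitary PU).
    by rewrite mulVmx ?spectral_unit // mulmx1.
  by rewrite mxE; apply: eq_bigr => i _; rewrite -yE !mxE.
Qed.

Lemma rayleigh_le (v : 'rV[R]_n) :
  (v *m A *m v^T) 0 0 <= (eigenvalues A)`_0 * (v *m v^T) 0 0.
Proof.
have [mu [w [muA w0 -> ->]]] := rayleigh_weights v.
rewrite mulr_sumr ler_sum // => i _.
by rewrite ler_wpM2r ?eigenvalues_le_head.
Qed.

Lemma rayleigh_ge (v : 'rV[R]_n) :
  (eigenvalues A)`_n.-1 * (v *m v^T) 0 0 <= (v *m A *m v^T) 0 0.
Proof.
have [mu [w [muA w0 -> ->]]] := rayleigh_weights v.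
rewrite mulr_sumr ler_sum // => i _.
by rewrite ler_wpM2r ?eigenvalues_ge_last.
Qed.

Lemma head_eigenvector : (0 < n)%N ->
  exists2 v : 'rV[R]_n, v *m A = (eigenvalues A)`_0 *: v & v != 0.
Proof.
move=> n0; have /mem_nth-/(_ 0) : (0 < size (eigenvalues A))%N.
  by rewrite size_eigenvalues.
by rewrite mem_eigenvalues -eigenvalue_root_char => /eigenvalueP.
Qed.

End Rayleigh.

(** * Quadratic forms of A and Q, and the eigenvalue bounds they give *)

Lemma sqnorm_rowE (R : comNzRingType) n (v : 'rV[R]_n) :
  (v *m v^T) 0 0 = \sum_i v 0 i ^+ 2.
Proof. by rewrite mxE; apply: eq_bigr => i _; rewrite mxE. Qed.

Section SignlessLaplacian.
Variables (R : rcfType) (n : nat) (e : rel 'I_n).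
Hypothesis e_sym : symmetric e.

Local Notation A := (adjacency_matrix R e).
Local Notation Q := (signless_laplacian R e).

Lemma adjacency_sym : A^T = A.
Proof. by apply/matrixP => i j; rewrite !mxE e_sym. Qed.

Lemma signless_sym : Q^T = Q.
Proof. by rewrite linearD /= tr_diag_mx adjacency_sym. Qed.

Lemma adjacency_form (v : 'rV[R]_n) :
  (v *m A *m v^T) 0 0 = \sum_i \sum_j (e i j)%:R * (v 0 i * v 0 j).
Proof.
rewrite mxE exchange_big /=; apply: eq_bigr => j _.
rewrite !mxE mulr_suml; apply: eq_bigr => i _; rewrite !mxE; ring.
Qed.

Lemma degree_form (v : 'rV[R]_n) :
  (v *m degree_matrix R e *m v^T) 0 0 = \sum_i \sum_j (e i j)%:R * v 0 i ^+ 2.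
Proof.
rewrite mul_mx_diag mxE; apply: eq_bigr => i _.
rewrite !mxE -mulr_suml -natr_sum.
have -> : degree e i = (\sum_j e i j)%N.
  rewrite /degree -sum1_card big_mkcond.
  by apply: eq_bigr => j _; rewrite inE; case: (e i j).
ring.
Qed.

(** The factor 2 appears because the sum runs over ordered pairs, meeting each edge twice. By
    symmetry, one copy of the degree form can be moved to the index [j], which completes the
    square. *)
Lemma signless_form (v : 'rV[R]_n) :
  2 * (v *m Q *m v^T) 0 0 = \sum_i \sum_j (e i j)%:R * (v 0 i + v 0 j) ^+ 2.
Proof.
rewrite mulmxDr mulmxDl mxE adjacency_form degree_form mulrDl mul1r.
have sumC : \sum_i \sum_j (e i j)%:R * v 0 i ^+ 2
          = \sum_i \sum_j (e i j)%:R * v 0 j ^+ 2.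
  by rewrite exchange_big; under eq_bigr do under eq_bigr do rewrite e_sym.
rewrite {2}sumC -!big_split; apply: eq_bigr => i _ /=.
by rewrite -!big_split; apply: eq_bigr => j _ /=; ring.
Qed.

Lemma signless_ge_adjacency (v : 'rV[R]_n) :
  2 * (v *m A *m v^T) 0 0 <= (v *m Q *m v^T) 0 0.
Proof.
rewrite -(ler_pM2l (ltr0n _ 2)) signless_form adjacency_form !mulr_sumr.
rewrite ler_sum // => i _; rewrite !mulr_sumr ler_sum // => j _.
(* Termwise, [(a + b) ^+ 2 - 4 * a * b = (a - b) ^+ 2]. *)
by have := sqr_ge0 (v 0 i - v 0 j); case: (e i j) => /=; nra.
Qed.

Lemma double_lambda1_le : (0 < n)%N -> 2 * lambda1 R e <= (eigenvalues Q)`_0.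
Proof.
move=> n0; have [v vA v0] := head_eigenvector _ _ _ adjacency_sym n0.
have vv_gt0 : 0 < (v *m v^T) 0 0.
  rewrite sqnorm_rowE lt_neqAle sumr_ge0 ?andbT => [|i _]; last exact: sqr_ge0.
  apply: contraNneq v0 => /esym/psumr_eq0P vv0; apply/eqP/rowP => i.
  by apply/eqP; rewrite mxE -sqrf_eq0 vv0 // => j _; apply: sqr_ge0.
rewrite -(ler_pM2r vv_gt0) (le_trans _ (rayleigh_le _ _ _ signless_sym v)) //.
apply: le_trans (signless_ge_adjacency v).
by rewrite vA -scalemxAl [X in _ <= _ * X]mxE mulrA.
Qed.

Lemma signless_last_le : irreflexive e -> (0 < n)%N ->
  (eigenvalues Q)`_n.-1 <= (vertex_bipartiteness e)%:R.
Proof.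
move=> e_irr n0; have [S bipS cardS] := vertex_bipartiteness_witness _ e.
have /bipartite_deleteP[X bipX] := bipS.
(* The test vector must be nonzero: a single vertex is independent, so fewer than [n] vertices are
   deleted. *)
have CS_gt0 : (0 < #|~: S|)%N.
  rewrite cardsCs setCK subn_gt0 cardS.
  have indep : independent e [set Ordinal n0].
    by apply/'forall_in_forall_inP => u /set1P-> v /set1P->; rewrite e_irr.
  have := vertex_bipartiteness_independent _ _ _ e_irr indep.
  by rewrite cards1 card_ord; lia.
pose v : 'rV[R]_n := \row_i ((i \notin S)%:R * (-1) ^+ (i \in X)).
have vv : (v *m v^T) 0 0 = #|~: S|%:R.
  rewrite sqnorm_rowE -sum1_card natr_sum [RHS]big_mkcond.
  apply: eq_bigr => i _; rewrite mxE exprMn sqrr_sign mulr1 inE.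
  by case: (i \in S); rewrite ?expr0n ?expr1n.
rewrite -cardS -(@ler_pM2r _ #|~: S|%:R) ?ltr0n // -vv.
apply: le_trans (rayleigh_ge _ _ _ signless_sym v) _.
rewrite -(ler_pM2l (ltr0n _ 2)) signless_form vv.
(* The bound is rewritten as a count of ordered pairs with exactly one end in [S], to compare
   termwise: an edge across contributes 1 to the form, an edge within [S] or within its complement
   0. *)
have -> : 2 * (#|S|%:R * #|~: S|%:R) =
    \sum_i \sum_j ((i \in S) * (j \in ~: S) + (i \in ~: S) * (j \in S))%:R :> R.
  have cardE (T : {set 'I_n}) : #|T|%:R = \sum_i (i \in T)%:R :> R.
    rewrite -sum1_card natr_sum big_mkcond.
    by apply: eq_bigr => i _; case: (i \in T).
  under eq_bigr do under eq_bigr do rewrite natrD !natrM.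
  under eq_bigr do rewrite big_split /= -!mulr_sumr -!cardE.
  rewrite big_split /= -!mulr_suml -!cardE; ring.
rewrite ler_sum // => i _; rewrite ler_sum // => j _; rewrite !mxE !inE.
have := bipX i j.
case: (i \in S); case: (j \in S); case: (i \in X); case: (j \in X);
  case: (e i j) => //= H; try (by have := H isT isT isT); lra.
Qed.

Lemma lambda1_ge_average_degree : irreflexive e -> (0 < n)%N ->
  2 * #|edges e|%:R / n%:R <= lambda1 R e.
Proof.
move=> e_irr n0; rewrite ler_pdivrMr ?ltr0n //.
have := rayleigh_le _ _ _ adjacency_sym (const_mx 1).
rewrite adjacency_form sqnorm_rowE.
under eq_bigr do under eq_bigr do rewrite !mxE !mulr1.
under [X in _ <= _ * X]eq_bigr do rewrite mxE expr1n.
rewrite sumr_const card_ord; under eq_bigr do rewrite -natr_sum.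
by rewrite -natr_sum handshake // natrM.
Qed.

End SignlessLaplacian.

Theorem corollary14 (R : rcfType) (n : nat) (e : rel 'I_n)
    (e_sym : symmetric e) (e_irr : irreflexive e)
    (e_noiso : no_isolated_vertex e)
    (alpha_m : (n%:R * (n%:R - (independence_number e)%:R)
                     * (n%:R - (independence_number e)%:R - 1)
                <= 8 * #|edges e|%:R :> R)) :
  [/\ signless_spread R e
        >= 2 * lambda1 R e - (vertex_bipartiteness e)%:R,
      2 * lambda1 R e - (vertex_bipartiteness e)%:R
        >= 4 * #|edges e|%:R / n%:R - (vertex_bipartiteness e)%:R
    & 4 * #|edges e|%:R / n%:R - (vertex_bipartiteness e)%:R >= 0 :> R].
Proof.
(* For [n = 0] the spectra are empty, so [nth] returns its default 0, and division by zero gives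
   0. *)
have [n0|n_gt0] := posnP n.
  have spec0 (M : 'M[R]_n) i : M^T = M -> (eigenvalues M)`_i = 0.
    by move=> symM; rewrite nth_default // size_eigenvalues // n0.
  have ub0 : vertex_bipartiteness e = 0%N.
    by apply/eqP; rewrite -leqn0 -[leqRHS]n0 -[leqRHS]card_ord max_card.
  have n0r : n%:R = 0 :> R by rewrite n0.
  rewrite /signless_spread /lambda1 !spec0 ?adjacency_sym ?signless_sym //.
  by rewrite ub0 n0r invr0 !mulr0 !subr0.
have n_gt0R : 0 < n%:R :> R by rewrite ltr0n.
have lambda1_ge := lambda1_ge_average_degree R _ _ e_sym e_irr n_gt0.
split.
- by rewrite lerB ?double_lambda1_le ?signless_last_le //.
- rewrite lerD2r; apply: le_trans (ler_wpM2l (ler0n _ 2) lambda1_ge).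
  by rewrite !mulrA -[2 * 2]natrM.
have [I indI cardI] : {I : {set 'I_n} | independent e I
                                      & independence_number e = #|I|}.
  apply: eq_bigmax_cond; apply/card_gt0P; exists set0.
  by apply/'forall_in_forall_inP => u; rewrite inE.
have := vertex_bipartiteness_independent _ _ _ e_irr indI.
rewrite -cardI card_ord => ub; rewrite subr_ge0 ler_pdivlMr //.
(* Here the truncated predecessor in [ub] is 0, so the graph is already bipartite. *)
have [le_na1|lt_1na] := leqP (n - independence_number e) 1.
  have -> : vertex_bipartiteness e = 0%N by lia.
  by rewrite mul0r mulr_ge0.
have ubR : (vertex_bipartiteness e)%:R
        <= n%:R - (independence_number e)%:R - 1 :> R.
  by rewrite !lerBrDr -[1]/(1%:R) -!natrD ler_nat; lia.
have naR : 2 <= n%:R - (independence_number e)%:R :> R.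
  by rewrite lerBrDr -natrD ler_nat; lia.
have uN := ler_wpM2r (ltW n_gt0R) ubR.
(* With [t = n - alpha >= 2], this says [2 * (t - 1) * n <= t * (t - 1) * n], which is at most
   [8 * m] by hypothesis; [uN] bounds the vertex bipartiteness times [n] by [(t - 1) * n]. *)
suff : 0 <= (n%:R - (independence_number e)%:R - 2)
          * ((n%:R - (independence_number e)%:R - 1) * n%:R) :> R by lra.
by rewrite !mulr_ge0 ?subr_ge0 ?(ltW n_gt0R) // (le_trans _ naR) ?ler1n.
Qed.
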